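(* Let $\overline{p}_{-k}(n)$ denote the number of $k$-colored overpartitions of $n$. If $a,b$ are positive integers and $k\ge2$ is an integer, then \[\overline{p}_{-k}(a)\,\overline{p}_{-k}(b)>\overline{p}_{-k}(a+b).\]
   Context: A $k$-colored overpartition of $n$ is a partition of $n$ in which each part is assigned one of $k$ colors, and for each pair (size, color) occurring, the last occurrence of a part of that size and color may be overlined. Equivalently, $\sum_{n\ge0}\overline{p}_{-k}(n)q^n=\Big(\prod_{n\ge1}\frac{1+q^n}{1-q^n}\Big)^k$. *)

(* Defs.v *)
From mathcomp Require Import all_boot.

Set Implicit Arguments.
Unset Strict Implicit.
Unset Printing Implicit Defensive.

(* A pair (i, c) : 'I_n * 'I_k stands for parts of size i.+1 and color c.
   Every part of a partition of n has size at most n and occurs at most n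
   times, so the bounds in the types below lose nothing.
   In a pair (m, o), m gives the multiplicity of each (size, color), and o is
   the set of those (size, color) whose last occurrence is overlined; each of
   these must occur. *)
Definition colored_overpartitions (k n : nat) :
    {set {ffun 'I_n * 'I_k -> 'I_n.+1} * {set 'I_n * 'I_k}} :=
  [set mo : {ffun 'I_n * 'I_k -> 'I_n.+1} * {set 'I_n * 'I_k} |
     (\sum_(x : 'I_n * 'I_k) mo.1 x * x.1.+1 == n)
     && (mo.2 \subset [set x | 0 < mo.1 x])].

Definition pbar (k n : nat) : nat := #|colored_overpartitions k n|.

(* Main.v *)
(** Call a sequence f submultiplicative if f (a + b) <= f a * f b. Convolution
    preserves this property, and makes it strict for a, b > 0, so it suffices
    to treat one color. Let F_m count the overpartitions with parts at most m,
    so that F_m(n) = F_m(n - m) + F_(m-1)(n) + F_(m-1)(n - m). We prove that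
    F_m is submultiplicative by induction on m. If a or b is at least m, the
    recurrence reduces the claim to smaller instances. If a <= b < m, then at
    most 2 * \sum_(i < a) F_i(i) overpartitions of a + b have a part larger
    than b, and this loss is compensated by the slack in
    F_b(a + b) <= F_b(a) * F_b(b): each passage from F_(j-1) to F_j with
    j <= a gains at least 2 F_(j-1)(a) >= 2 F_(j-1)(j-1) (for j > 1), because
    at least two overpartitions of b have largest part j. *)

Require Import Defs.
From mathcomp Require Import all_boot.
From mathcomp Require Import ssralg poly zify.

Set Implicit Arguments.
Unset Strict Implicit.
Unset Printing Implicit Defensive.

(** * Overpartitions with bounded parts: recurrence and monotonicity *)

Definition conv (f g : nat -> nat) (n : nat) : nat :=
  \sum_(i < n.+1) f i * g (n - i).

Definition submul (f : nat -> nat) : Prop :=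
  forall a b, f (a + b) <= f a * f b.

(** The number of overlining choices for [j] parts of equal size and color. *)
Definition wt (j : nat) : nat := if j == 0 then 1 else 2.

(* The coefficient of q^n in (1 + q^d) / (1 - q^d). *)
Definition part_coef (d n : nat) : nat := if d %| n then wt n else 0.

(* ovp m n counts the overpartitions of n with all parts at most m. *)
Fixpoint ovp (m : nat) : nat -> nat :=
  if m is m'.+1 then conv (ovp m') (part_coef m) else fun n => n == 0.

Lemma ovp_small m n : n <= m -> ovp m.+1 n = ovp m n.
Proof.
move=> le_nm; rewrite /= /conv big_ord_recr /= subnn big1 ?add0n.
  by rewrite /part_coef dvdn0 muln1.
move=> i _; rewrite /part_coef gtnNdvd ?muln0 //.
  by rewrite subn_gt0.
by rewrite ltnS (leq_trans (leq_subr _ _)).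
Qed.

(* (1 - q^d) F_d = (1 + q^d) F_(d-1), with d = m + 1. *)
Lemma ovp_rec m n :
  ovp m.+1 (n + m.+1) = ovp m.+1 n + ovp m (n + m.+1) + ovp m n.
Proof.
rewrite /= /conv.
rewrite -(big_mkord xpredT (fun i => ovp m i * part_coef m.+1 (n + m.+1 - i))).
rewrite (@big_cat_nat _ _ _ n.+1) //=; last by lia.
rewrite big_mkord addnS [X in _ + X]big_nat_recr /=; last by lia.
rewrite [X in _ + (X + _)]big1_seq ?add0n; last first.
  move=> i /=; rewrite mem_index_iota => /andP[le_ni lt_in].
  rewrite /part_coef gtnNdvd ?muln0 //; lia.
rewrite -!addnS !big_ord_recr /= addKn subnn.
have -> : part_coef m.+1 m.+1 = 2 by rewrite /part_coef dvdnn.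
have e0 : part_coef m.+1 0 = 1 by rewrite /part_coef dvdn0.
rewrite !subnn e0 (eq_bigr (fun i : 'I_n => ovp m i * part_coef m.+1 (n - i))).
  lia.
move=> [i lt_in] _ /=; congr (_ * _).
have -> : n + m.+1 - i = n - i + m.+1 by lia.
rewrite /part_coef dvdn_addl // /wt.
have -> : (n - i + m.+1 == 0) = false by lia.
by have -> : (n - i == 0) = false by lia.
Qed.

Lemma ovp0 m : ovp m 0 = 1.
Proof. by elim: m => // m IH; rewrite ovp_small. Qed.

Lemma ovp_stable m n : n <= m -> ovp m n = ovp n n.
Proof.
elim: m => [|m IH]; first by rewrite leqn0 => /eqP->.
by rewrite leq_eqVlt => /predU1P[->//|lt_nm]; rewrite ovp_small // IH.
Qed.

Lemma ovp_recB m n : m < n ->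
  ovp m.+1 n = ovp m.+1 (n - m.+1) + ovp m n + ovp m (n - m.+1).
Proof. by move=> lt_mn; rewrite -{1 3}(subnK lt_mn) ovp_rec. Qed.

Lemma leq_ovp_parts m n : ovp m n <= ovp m.+1 n.
Proof.
case: (leqP n m) => [le_nm|lt_mn]; first by rewrite ovp_small.
by rewrite (ovp_recB lt_mn) addnAC leq_addl.
Qed.

(** The index is a successor because [ovp 0] drops from 1 to 0. *)
Lemma leq_ovpS m n : ovp m.+1 n <= ovp m.+1 n.+1.
Proof.
elim: m n => [|m IHm] n.
  by rewrite -[n.+1]addn1 ovp_rec -addnA leq_addr.
elim/ltn_ind: n => n IHn.
case: (ltngtP n m.+1) => [lt_nm|lt_mn|->].
- by rewrite (ovp_small (ltnW lt_nm)) (ovp_small lt_nm).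
- rewrite ovp_recB // (@ovp_recB _ n.+1); last by lia.
  rewrite subSn //.
  have := IHn (n - m.+2); have := IHm n; have := IHm (n - m.+2); lia.
rewrite ovp_small // (@ovp_recB m.+1 m.+2) //.
have := IHm m.+1; lia.
Qed.

Lemma leq_ovp m n1 n2 : 0 < m -> n1 <= n2 -> ovp m n1 <= ovp m n2.
Proof.
case: m => // m _; elim: n2 => [|n2 IH]; first by rewrite leqn0 => /eqP->.
rewrite leq_eqVlt => /predU1P[->//|lt12].
by apply: leq_trans (leq_ovpS _ _); apply: IH.
Qed.

Lemma ovp_ge2 m n : 0 < m -> 0 < n -> 2 <= ovp m n.
Proof.
move=> m0 n0; apply: (@leq_trans (ovp m 1)); last exact: leq_ovp.
by rewrite ovp_stable // ovp_recB // !ovp0.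
Qed.

(** The two terms of the recurrence at [b - m.+1] are both 1 if [b = m.+1]; otherwise the first is
    already at least 2. *)
Lemma ovp_largest_ge2 m b : m < b -> ovp m b + 2 <= ovp m.+1 b.
Proof.
move=> lt_mb; rewrite ovp_recB //.
case: (posnP (b - m.+1)) => [->|b0]; first by rewrite !ovp0; lia.
have := @ovp_ge2 m.+1 _ isT b0; lia.
Qed.

(** * Slack and submultiplicativity for one color *)

Definition psum (n : nat) : nat := \sum_(i < n) ovp i i.

Lemma psumS n : psum n.+1 = psum n + ovp n n.
Proof. by rewrite /psum big_ord_recr. Qed.

(* The overpartitions of a + b with a part larger than b >= a: the remaining
   parts form an arbitrary overpartition of some i < a. *)
Lemma ovp_large_parts a b d : a <= b ->
  ovp (b + d) (a + b) + 2 * psum (a - d) <= ovp b (a + b) + 2 * psum a.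
Proof.
move=> le_ab; elim: d => [|d IH]; first by rewrite addn0 subn0.
rewrite addnS; case: (ltnP d a) => [lt_da|le_ad]; last first.
  rewrite ovp_small; last by lia.
  have e1 : a - d = 0 by lia.
  have e2 : a - d.+1 = 0 by lia.
  by move: IH; rewrite e1 e2.
have e : a - d = (a - d.+1).+1 by lia.
(* Both new terms of the recurrence equal [ovp i i] with [i = a - d.+1], the last summand of
   [psum (a - d)]. *)
move: IH; rewrite e psumS ovp_recB; last by lia.
have -> : a + b - (b + d).+1 = a - d.+1 by lia.
rewrite (@ovp_stable (b + d).+1 (a - d.+1)); last by lia.
rewrite (@ovp_stable (b + d) (a - d.+1)); last by lia.
lia.
Qed.

Lemma psum_gt0 n : 0 < n -> 0 < psum n.
Proof. by case: n => // n _; rewrite /psum big_ord_recl. Qed.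

(* Write G_j = ovp j a * ovp j b - ovp j (a + b); the recurrence ovp_recB in a
   gives G_(j+1)(a, b) >= G_j(a, b) up to the stated gain. *)
Lemma ovp_slack_step j a b t e : j < a ->
  ovp j.+1 (a - j.+1 + b) <= ovp j.+1 (a - j.+1) * ovp j.+1 b ->
  ovp j (a - j.+1 + b) <= ovp j (a - j.+1) * ovp j b ->
  ovp j b + e <= ovp j.+1 b ->
  ovp j (a + b) + t <= ovp j a * ovp j b ->
  ovp j.+1 (a + b) + t + e * (ovp j a + ovp j (a - j.+1))
    <= ovp j.+1 a * ovp j.+1 b.
Proof.
move=> lt_ja s1 s2 le_e le_t.
rewrite ovp_recB; last by lia.
rewrite (ovp_recB lt_ja) -addnBAC //.
move: s1 s2 le_e le_t.
move: (ovp _ (_ - _ + b)) (ovp _ (_ - _ + b)) (ovp _ (a + b)) => S1 S3 S2.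
move: (ovp _ (_ - _)) (ovp _ (_ - _)) (ovp _ a) => A1 A3 A2.
move: (ovp _ b) (ovp _ b) => B B' s1 s3 le_e le_t.
have : (A2 + A3) * (B + e) <= (A2 + A3) * B' by rewrite leq_mul2l le_e orbT.
nia.
Qed.

(** The predecessor accounts for the passage from 0 to 1, which gains nothing: [ovp 0 a] and
    [ovp 0 (a - 1)] vanish for [a > 1]. *)
Lemma ovp_slack_lt a b j : a <= b -> (forall m, m <= b -> submul (ovp m)) ->
  j < a -> ovp j (a + b) + 2 * (psum j).-1 <= ovp j a * ovp j b.
Proof.
move=> le_ab sub; elim: j => [|j IH] lt_ja.
  by rewrite /psum big_ord0 /=; have -> : (a + b == 0) = false by lia.
have lt_jb : j < b by lia.
have := ovp_slack_step (ltnW lt_ja) (sub _ lt_jb _ _) (sub _ (ltnW lt_jb) _ _)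
  (ovp_largest_ge2 lt_jb) (IH (ltnW lt_ja)).
apply: leq_trans; rewrite psumS.
case: (posnP j) => [->|j0]; first by rewrite /psum big_ord0 /=; lia.
have := psum_gt0 j0; have := @leq_ovp j j a j0; lia.
Qed.

(** In the passage from [a - 1] to [a], the gain contains [ovp (a - 1) 0 = 1], which restores the
    missing unit. *)
Lemma ovp_slack_diag a b : 0 < a <= b ->
  (forall m, m <= b -> submul (ovp m)) ->
  ovp a (a + b) + 2 * psum a <= ovp a a * ovp a b.
Proof.
case: a => // j /andP[_ lt_jb] sub.
have := ovp_slack_step (ltnSn j) (sub _ lt_jb _ _) (sub _ (ltnW lt_jb) _ _)
  (ovp_largest_ge2 lt_jb) (ovp_slack_lt lt_jb sub (ltnSn j)).
apply: leq_trans; rewrite psumS subnn ovp0.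
case: (posnP j) => [->|j0]; first by rewrite /psum big_ord0 /=; lia.
have := psum_gt0 j0; have := @leq_ovp j j j.+1 j0; lia.
Qed.

(** Beyond [a] the factor [ovp j a] is constant, so the recurrence is applied in [b] with gain 0,
    and the slack persists. *)
Lemma ovp_slack a b j : 0 < a -> a <= j <= b ->
  (forall m, m <= b -> submul (ovp m)) ->
  ovp j (a + b) + 2 * psum a <= ovp j a * ovp j b.
Proof.
move=> a0 + sub; elim: j => [|j IH] /andP[le_aj le_jb]; first by lia.
move: le_aj; rewrite leq_eqVlt => /predU1P[eaj|le_aj].
  by rewrite -eaj in le_jb *; apply: ovp_slack_diag => //; rewrite a0.
have le_e : ovp j a + 0 <= ovp j.+1 a by rewrite addn0 ovp_small.
have := IH; rewrite -ltnS le_aj (ltnW le_jb) => /(_ isT).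
rewrite [ovp j a * _]mulnC [a + b]addnC => le_t.
have := ovp_slack_step le_jb (sub _ le_jb _ _) (sub _ (ltnW le_jb) _ _) le_e le_t.
by rewrite mul0n addn0 [ovp _ b * _]mulnC.
Qed.

Lemma submul_ovp m : submul (ovp m).
Proof.
elim/ltn_ind: m => m IHm.
have ltm a b : 0 < a -> a <= b -> b < m -> ovp m (a + b) <= ovp m a * ovp m b.
  move=> a0 le_ab lt_bm.
  have s := @ovp_slack a b b a0.
  have {}s : ovp b (a + b) + 2 * psum a <= ovp b a * ovp b b.
    by apply: s => [|j le_jb]; [rewrite le_ab /= | apply: IHm; lia].
  (* Parts larger than [b] cost at most the slack [2 * psum a]. *)
  have := ovp_large_parts (m - b) le_ab; rewrite subnKC; last exact: ltnW.
  rewrite (@ovp_stable m a) ?(@ovp_stable m b) -1?(@ovp_stable b a) //; lia.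
move=> a b; have [n] := ubnP (a + b); elim: n a b => // n IHn a b.
wlog le_ab : a b / a <= b.
  move=> W lt_n; case/orP: (leq_total a b) => le; first exact: W.
  by rewrite addnC mulnC W // addnC.
move=> lt_n; case: (posnP a) => [->|a0]; first by rewrite ovp0 mul1n.
case: (ltnP b m) => [lt_bm|le_mb]; first exact: ltm.
case: m IHm {ltm} IHn le_mb => [|m] IHm IHn le_mb.
  by rewrite /=; have -> : (a + b == 0) = false by lia.
have le_e : ovp m a + 0 <= ovp m.+1 a by rewrite addn0 leq_ovp_parts.
have le_t : ovp m (b + a) + 0 <= ovp m b * ovp m a by rewrite addn0 IHm.
have s1 : ovp m.+1 (b - m.+1 + a) <= ovp m.+1 (b - m.+1) * ovp m.+1 a.
  by apply: IHn; lia.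
have := ovp_slack_step le_mb s1 (IHm _ (ltnSn m) _ _) le_e le_t.
by rewrite mul0n !addn0 addnC [ovp _ b * _]mulnC.
Qed.

(** * Convolution and several colors *)

(* Every s <= a + b is i + j for some i <= a and j <= b, and s = 1 is so in two
   ways, whence the strictness. *)
Lemma submul_conv_lt f g a b : submul f -> submul g ->
  0 < a -> 0 < b -> (forall n, 0 < f n) -> (forall n, 0 < g n) ->
  conv f g (a + b) < conv f g a * conv f g b.
Proof.
move=> sf sg a0 b0 f0 g0; pose T s := f s * g (a + b - s).
apply: (@leq_trans (\sum_(i < a.+1) \sum_(j < b.+1) T (i + j))); last first.
  rewrite /conv big_distrlr /=; apply: leq_sum => -[i /= lt_i] _.
  apply: leq_sum => -[j /= lt_j] _; rewrite /T mulnACA leq_mul //.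
  by have -> : a + b - (i + j) = (a - i) + (b - j) by [lia]; apply: sg.
(* Row [i = a] supplies all [s >= a], and the entries [j = 0] of the other rows supply [s < a]; the
   entry [j = 1] of row 0 is the surplus. *)
rewrite big_ord_recr /= /conv.
rewrite -(big_mkord xpredT T) (@big_cat_nat _ _ _ a) //=; last by lia.
have -> : \sum_(a <= i < (a + b).+1) T i = \sum_(j < b.+1) T (a + j).
  rewrite -{1}[a]add0n big_addn -addnS addKn big_mkord.
  by apply: eq_bigr => j _; rewrite addnC.
rewrite -addSn leq_add2r big_mkord.
have le_row i : T i <= \sum_(j < b.+1) T (i + j).
  by rewrite big_ord_recl addn0 leq_addr.
have lt_row0 : T 0 < \sum_(j < b.+1) T (0 + j).
  case: b b0 @T {le_row} => // b _ T.
  rewrite big_ord_recl addn0 -addn1 leq_add2l big_ord_recl.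
  by rewrite (leq_trans _ (leq_addr _ _)) // muln_gt0 f0 g0.
case: a a0 @T le_row lt_row0 => // a _ T le_row lt_row0.
rewrite big_ord_recl [X in _ < X]big_ord_recl -addSn.
by apply: leq_add; last by apply: leq_sum.
Qed.

Lemma submul_conv f g : submul f -> submul g -> f 0 = 1 -> g 0 = 1 ->
  (forall n, 0 < f n) -> (forall n, 0 < g n) -> submul (conv f g).
Proof.
move=> sf sg f1 g1 f0 g0 a b.
have c0 : conv f g 0 = 1 by rewrite /conv big_ord1 f1 g1.
case: (posnP a) => [->|a0]; first by rewrite c0 mul1n.
case: (posnP b) => [->|b0]; first by rewrite c0 muln1 addn0.
by apply/ltnW/submul_conv_lt.
Qed.

Definition ovp1 (n : nat) : nat := ovp n n.

Lemma submul_ovp1 : submul ovp1.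
Proof.
move=> a b; rewrite /ovp1 -(@ovp_stable (a + b) a) ?leq_addr //.
by rewrite -(@ovp_stable (a + b) b) ?leq_addl // submul_ovp.
Qed.

Lemma ovp1_gt0 n : 0 < ovp1 n.
Proof. by case: n => // n; apply: leq_trans (@ovp_ge2 n.+1 n.+1 _ _). Qed.

Fixpoint ovpk (k : nat) : nat -> nat :=
  if k is k'.+1 then conv (ovpk k') ovp1 else fun n => n == 0.

Lemma ovpk0 k : ovpk k 0 = 1.
Proof. by elim: k => //= k IH; rewrite /conv big_ord1 IH. Qed.

Lemma ovpk_gt0 k n : 0 < ovpk k.+1 n.
Proof.
rewrite /= /conv big_ord_recl ovpk0 mul1n subn0.
by rewrite (leq_trans (ovp1_gt0 n)) ?leq_addr.
Qed.

Lemma ovpk1 n : ovpk 1 n = ovp1 n.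
Proof.
by rewrite /= /conv big_ord_recl subn0 mul1n big1 ?addn0.
Qed.

Lemma submul_ovpk k : submul (ovpk k.+1).
Proof.
elim: k => [|k IH]; first by move=> a b; rewrite !ovpk1; apply: submul_ovp1.
exact: (submul_conv IH submul_ovp1 (ovpk0 _) _ (@ovpk_gt0 k) ovp1_gt0).
Qed.

(** * From the combinatorial count to iterated convolutions *)

Section GeneratingFunction.

Local Open Scope ring_scope.

(* The factor (1 + q^d) / (1 - q^d), with multiplicities truncated at N. *)
Definition part_poly (N d : nat) : {poly nat} :=
  \sum_(j < N.+1) wt j *: 'X^(j * d).

Lemma coef_part_poly N d n : (n <= N)%N ->
  (part_poly N d.+1)`_n = part_coef d.+1 n.
Proof.
move=> le_nN; rewrite coef_sum /part_coef.
under eq_bigr do rewrite coefZ coefXn.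
case: ifP => [/dvdnP[j ej]|ndv]; last first.
  rewrite big1 // => j _; case: eqP => [e|_]; last by rewrite GRing.mulr0.
  by rewrite e dvdn_mull in ndv.
have lt_jN : (j < N.+1)%N by nia.
rewrite (bigD1 (Ordinal lt_jN)) //= ej eqxx GRing.mulr1 big1 ?GRing.addr0.
  by rewrite /wt muln_eq0 orbF.
move=> i /eqP ne_ij; rewrite eqn_pmul2r //; case: eqP => [e|_].
  by case: ne_ij; apply: val_inj.
by rewrite GRing.mulr0.
Qed.

Lemma coef_mul_conv (p q : {poly nat}) f g N n :
  (forall i, (i <= N)%N -> p`_i = f i) -> (forall i, (i <= N)%N -> q`_i = g i) ->
  (n <= N)%N -> (p * q)`_n = conv f g n.
Proof.
move=> ep eq le_nN; rewrite coefM /conv; apply: eq_bigr => -[i /= lt_i] _.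
by rewrite ep ?eq //; lia.
Qed.

Lemma coef_prod_part_poly N m n : (n <= N)%N ->
  (\prod_(i < m) part_poly N i.+1)`_n = ovp m n.
Proof.
elim: m n => [|m IH] n le_nN; first by rewrite big_ord0 coef1; case: n le_nN.
rewrite big_ord_recr.
exact: (coef_mul_conv IH (@coef_part_poly N m) le_nN).
Qed.

Lemma coef_exp_ovpk (p : {poly nat}) N k n :
  (forall i, (i <= N)%N -> p`_i = ovp1 i) -> (n <= N)%N ->
  (p ^+ k)`_n = ovpk k n.
Proof.
move=> ep; elim: k n => [|k IH] n le_nN; first by rewrite coef1; case: n le_nN.
rewrite GRing.exprSr; exact: (coef_mul_conv IH ep le_nN).
Qed.

(** Expanding the product chooses all multiplicities; the weights [wt] multiply to the number of
    possible overlined sets. *)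
Lemma pbar_coef k n :
  pbar k n = (\prod_(x : 'I_n * 'I_k) part_poly n x.1.+1)`_n.
Proof.
rewrite bigA_distr_bigA coef_sum.
transitivity (\sum_(m : {ffun 'I_n * 'I_k -> 'I_n.+1}
    | (\sum_x m x * x.1.+1 == n)%N) 2 ^ #|[set x | (0 < m x)%N]|)%N.
  rewrite /pbar -sum1_card.
  under eq_bigl do rewrite inE.
  rewrite -(pair_big_dep (fun m : {ffun 'I_n * 'I_k -> 'I_n.+1} =>
    \sum_x m x * x.1.+1 == n)%N (fun m (o : {set 'I_n * 'I_k}) => o \subset [set x | (0 < m x)%N])
    (fun _ _ => 1%N)) /=.
  apply: eq_bigr => m _; rewrite -card_powerset -sum1_card.
  by apply: eq_bigl => o; rewrite inE.
rewrite big_mkcond; apply: eq_bigr => m _.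
rewrite GRing.scaler_prod coefZ GRing.prodrXr coefXn eq_sym.
case: eqP => _; last by rewrite GRing.mulr0.
rewrite GRing.mulr1 -prod_nat_const big_mkcond; apply: eq_bigr => x _.
by rewrite inE /wt lt0n; case: eqP.
Qed.

Lemma pbar_ovpk k n : pbar k n = ovpk k n.
Proof.
rewrite pbar_coef -(pair_bigA _ (fun (i : 'I_n) (_ : 'I_k) => part_poly n i.+1)) /=.
under eq_bigr do rewrite GRing.prodr_const card_ord.
rewrite GRing.prodrXl; apply: (@coef_exp_ovpk _ n) => // i le_in.
by rewrite coef_prod_part_poly // ovp_stable.
Qed.

End GeneratingFunction.

Theorem theorem1p8 (k a b : nat) (hk : 2 <= k) (ha : 0 < a) (hb : 0 < b) :
  pbar k a * pbar k b > pbar k (a + b).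
Proof.
case: k hk => [|[|k]] // _; rewrite !pbar_ovpk.
(* With two or more colors, splitting one off leaves a positive submultiplicative sequence, so the
   strict bound applies. *)
exact: (submul_conv_lt (@submul_ovpk k) submul_ovp1 ha hb (ovpk_gt0 k) ovp1_gt0).
Qed.
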